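(* Let $n\ge 1$. For every function $f:\{0,1\}^n\to\{0,1\}$, $b_{avg}(f)\le 64n$. In particular, taking $m=2^{2^n-1}$, we have $b_m(f)\le 32n\,2^{2^n}$.
   Context: A branching program on variables $x_1,\dots,x_n$ is a finite directed acyclic multigraph $G$ with labeled edges and distinguished sets of start nodes, accept nodes and reject nodes such that: every vertex has outdegree $0$ or $2$; for each vertex of outdegree $2$ there is an $i\in[1,n]$ such that one outgoing edge is labeled $x_i=0$ and the other is labeled $x_i=1$; every vertex of outdegree $0$ is an accept node or a reject node. On input $x\in\{0,1\}^n$, starting from a start node $s$, one follows the unique path whose edge labels agree with $x$ until reaching a vertex of outdegree $0$. The size of $G$ is $|V(G)|$. A branching program computes $f$ $m$ times if it has $m$ start nodes $s_1,\dots,s_m$, $m$ accept nodes $a_1,\dots,a_m$ and $m$ reject nodes $r_1,\dots,r_m$, and for every $i$ and every input $x$, the computation starting at $s_i$ on input $x$ ends at $a_i$ if $f(x)=1$ and at $r_i$ if $f(x)=0$. $b_m(f)$ denotes the minimum size of a branching program computing $f$ $m$ times, and $b_{avg}(f)=\lim_{m\to\infty} b_m(f)/m$ (this limit exists and equals $\inf_{m\ge1} b_m(f)/m$). *)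

(* Defs.v *)
From HB Require Import structures.
From mathcomp Require Import all_boot all_order all_algebra.
From mathcomp Require Import all_classical all_reals all_analysis.
Set Implicit Arguments.
Unset Strict Implicit.
Unset Printing Implicit Defensive.
Import Order.TTheory GRing.Theory Num.Theory.
Import numFieldNormedType.Exports.

(* The edge label [(i, b)] stands for "x_i = b". *)
Record lgraph (n : nat) := LGraph {
  vertex : finType;
  edge : finType;
  src : edge -> vertex;
  tgt : edge -> vertex;
  label : edge -> 'I_n * bool;
  starts : {set vertex};
  accepts : {set vertex};
  rejects : {set vertex}
}.

Definition bsize (n : nat) (G : lgraph n) : nat := #|vertex G|.

Definition out_edges (n : nat) (G : lgraph n) (v : vertex G) : {set edge G} :=
  [set e | src e == v].

Definition outdegree (n : nat) (G : lgraph n) (v : vertex G) : nat :=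
  #|out_edges v|.

Definition adj (n : nat) (G : lgraph n) : rel (vertex G) :=
  fun u v => [exists e : edge G, (src e == u) && (tgt e == v)].

Definition acyclic (n : nat) (G : lgraph n) : Prop :=
  forall (v : vertex G) (c : seq (vertex G)), ~~ cycle (@adj n G) (v :: c).

(* Disjointness of the accept and reject nodes is implicit in calling them
   distinguished: if a node could be both, a single node of outdegree 0 would
   compute every function. A start node may itself be a terminal node. *)
Record branching_program (n : nat) (G : lgraph n) : Prop := {
  bp_acyclic : acyclic G;
  bp_outdegree : forall v : vertex G, outdegree v = 0 \/ outdegree v = 2;
  bp_label : forall v : vertex G, outdegree v = 2 ->
    exists (i : 'I_n) (e0 e1 : edge G),
      [/\ out_edges v = [set e0; e1], label e0 = (i, false)
        & label e1 = (i, true)];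
  bp_terminal : forall v : vertex G, outdegree v = 0 ->
    v \in accepts G \/ v \in rejects G;
  bp_disjoint : [disjoint accepts G & rejects G]
}.

Fixpoint walk (n : nat) (G : lgraph n) (u : vertex G) (p : seq (edge G))
    (v : vertex G) : bool :=
  if p is e :: p' then (src e == u) && walk (tgt e) p' v else u == v.

Definition agrees (n : nat) (G : lgraph n) (x : {ffun 'I_n -> bool})
    (e : edge G) : bool :=
  x (label e).1 == (label e).2.

Definition computation_ends (n : nat) (G : lgraph n) (x : {ffun 'I_n -> bool})
    (s t : vertex G) : Prop :=
  outdegree t = 0 /\ exists p : seq (edge G), walk s p t /\ all (agrees x) p.

Definition computes_times (n : nat) (G : lgraph n) (m : nat)
    (f : {ffun 'I_n -> bool} -> bool) : Prop :=
  exists s a r : 'I_m -> vertex G,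
    [/\ [/\ injective s, injective a & injective r],
        [/\ starts G = [set s i | i : 'I_m]%SET,
            accepts G = [set a i | i : 'I_m]%SET
          & rejects G = [set r i | i : 'I_m]%SET]
      & forall (i : 'I_m) (x : {ffun 'I_n -> bool}),
          computation_ends x (s i) (if f x then a i else r i)].

Definition bp_size_achieved (n m : nat) (f : {ffun 'I_n -> bool} -> bool)
    (k : nat) : Prop :=
  exists G : lgraph n,
    [/\ branching_program G, computes_times G m f & bsize G = k].

(* Nonemptiness of the set of sizes: m disjoint copies of a program that reads
   x_0, ..., x_{n-1} in order and remembers all the values read. *)
Section FullProgram.
Variables (n m : nat) (f : {ffun 'I_n -> bool} -> bool).

Let input := {ffun 'I_n -> bool}.
Let state := (('I_n * input) + bool)%type.

Let upd (y : input) (k : 'I_n) (b : bool) : input :=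
  [ffun i => if i == k then b else y i].

Let at_level (k : nat) (y : input) : state :=
  if insub k is Some k' then inl (k', y) else inr (f y).

Let step (k : 'I_n) (y : input) (b : bool) : state :=
  at_level k.+1 (upd y k b).

Definition full_program : lgraph n :=
  @LGraph n ('I_m * state)%type ('I_m * ('I_n * input) * bool)%type
    (fun e => (e.1.1, inl e.1.2))
    (fun e => (e.1.1, step e.1.2.1 e.1.2.2 e.2))
    (fun e => (e.1.2.1, e.2))
    [set (i, at_level 0 [ffun=> false]) | i : 'I_m]%SET
    [set (i, inr true) | i : 'I_m]%SET
    [set (i, inr false) | i : 'I_m]%SET.

Let G := full_program.

Let rank (v : vertex G) : nat := if v.2 is inl (k, _) then k else n.

Lemma full_program_rank (u v : vertex G) : adj u v -> rank u < rank v.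
Proof.
case/existsP => -[[i [k y]] b] /andP[/eqP <- /eqP <-] /=.
rewrite /rank /= /step /at_level; case: insubP => [k' _ -> //|_ /=].
exact: ltn_ord.
Qed.

Lemma full_program_acyclic : acyclic G.
Proof.
move=> v c; apply/negP => /= vc.
have: path (fun u w : vertex G => rank u < rank w) v (rcons c v).
  by apply: sub_path vc; exact: full_program_rank.
have tr : transitive (fun u w : vertex G => rank u < rank w).
  by move=> a b d; exact: ltn_trans.
move/(order_path_min tr)/allP/(_ v).
by rewrite mem_rcons mem_head ltnn => /(_ isT).
Qed.

Lemma full_program_out_inl (i : 'I_m) (k : 'I_n) (y : input) :
  out_edges ((i, inl (k, y)) : vertex G) =
  [set ((i, (k, y), false) : edge G); ((i, (k, y), true) : edge G)]%SET.
Proof.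
apply/setP => -[[j [l z]] b]; rewrite !inE /=.
apply/eqP/orP => [[-> -> ->]|[]/eqP[-> -> -> _ //]].
by case: b; [right | left].
Qed.

Lemma full_program_out_inr (i : 'I_m) (b : bool) :
  out_edges ((i, inr b) : vertex G) = finset.set0.
Proof. by apply/setP => -[[j [l z]] c]; rewrite !inE /=; apply/eqP => -[]. Qed.

Lemma full_program_outdegree_inl (i : 'I_m) (k : 'I_n) (y : input) :
  outdegree ((i, inl (k, y)) : vertex G) = 2.
Proof. by rewrite /outdegree full_program_out_inl cards2; case: eqP => // -[]. Qed.

Lemma full_program_outdegree_inr (i : 'I_m) (b : bool) :
  outdegree ((i, inr b) : vertex G) = 0.
Proof. by rewrite /outdegree full_program_out_inr cards0. Qed.

Lemma full_program_branching : branching_program G.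
Proof.
split.
- exact: full_program_acyclic.
- move=> [i [[k y]|b]]; first by right; exact: full_program_outdegree_inl.
  by left; exact: full_program_outdegree_inr.
- move=> [i [[k y]|b]]; last by rewrite full_program_outdegree_inr.
  move=> _; exists k, (i, (k, y), false), (i, (k, y), true).
  by split=> //; exact: full_program_out_inl.
- move=> [i [[k y]|b]]; first by rewrite full_program_outdegree_inl.
  by move=> _; case: b; [left | right]; apply/imsetP; exists i.
- rewrite -setI_eq0; apply/eqP/setP => v; rewrite !inE.
  by apply/negP => /andP[/imsetP[i _ ->] /imsetP[j _]].
Qed.

Lemma full_program_walk (i : 'I_m) (x : input) (d k : nat) (y : input) :
    k + d = n -> (forall j : 'I_n, j < k -> y j = x j) ->
  exists p : seq (edge G),
    @walk n G (i, at_level k y) p (i, inr (f x)) /\ all (agrees x) p.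
Proof.
elim: d k y => [|d IHd] k y.
  rewrite addn0 => -> yx; exists [::]; split=> //=.
  have -> : y = x by apply/ffunP => j; exact: yx.
  by rewrite /at_level insubF ?ltnn.
move=> kdn yx.
have kn : k < n by rewrite -kdn -addSnnS leq_addr.
pose k' := Ordinal kn.
have [||p [wp ap]] := IHd k.+1 (upd y k' (x k')).
- by rewrite addSnnS.
- move=> j jk; rewrite ffunE; case: eqVneq => [-> //|jk'].
  apply: yx; rewrite ltn_neqAle -ltnS jk andbT.
  by apply: contra jk' => /eqP jk'; apply/eqP/val_inj.
exists (((i, (k', y), x k') : edge G) :: p); split => /=.
  by rewrite /at_level (insubT (fun j => j < n) kn) eqxx.
by rewrite ap andbT /agrees.
Qed.

Lemma full_program_computes : computes_times G m f.
Proof.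
exists (fun i => (i, at_level 0 [ffun=> false])), (fun i => (i, inr true)),
  (fun i => (i, inr false)); split=> //.
  by split=> i j [].
move=> i x; have -> : (if f x then (i, inr true) else (i, inr false)) =
  (i, inr (f x)) :> vertex G by case: (f x).
split; first exact: full_program_outdegree_inr.
by apply: (@full_program_walk i x n 0).
Qed.

End FullProgram.

Lemma bp_size_achieved_ex (n m : nat) (f : {ffun 'I_n -> bool} -> bool) :
  exists k : nat, `[< bp_size_achieved m f k >].
Proof.
exists (bsize (full_program m f)); apply/asboolP; exists (full_program m f).
by split=> //; [exact: full_program_branching | exact: full_program_computes].
Qed.

Definition b_ (n m : nat) (f : {ffun 'I_n -> bool} -> bool) : nat :=
  ex_minn (bp_size_achieved_ex m f).

Local Open Scope ring_scope.
Local Open Scope classical_set_scope.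

(* The value at m = 0 is irrelevant to the limit. *)
Definition b_ratio (R : realType) (n : nat) (f : {ffun 'I_n -> bool} -> bool) :
    R^nat :=
  fun m => (b_ m f)%:R / m%:R.

Definition b_avg (R : realType) (n : nat) (f : {ffun 'I_n -> bool} -> bool) :
    R :=
  lim (b_ratio R f @ \oo).

(* Main.v *)
(* Let a program carry a state (g, b) with g : {0,1}^n -> {0,1} and b a bit.
   Reading x_1, ..., x_n once turns g into g(. + x), one coordinate shift at a
   time; then g(x) is the value at 0, so it can be added to b, and a second
   reading undoes the shift.  Doing this for g and then for g + f adds
   g(x) + (g + f)(x) = f(x) to b and restores g, in 4n + 4 layers.  Since g is
   restored, each of the 2^(2^n) initial states (g, 0) has its own pair of final
   states, and all of them share the same 2 * 2^(2^n) nodes per layer.  The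
   limit exists and is bounded by each ratio by Fekete's lemma, b_m being
   subadditive through disjoint unions. *)
Require Import Defs.
From HB Require Import structures.
From mathcomp Require Import all_boot all_order all_algebra.
From mathcomp Require Import all_classical all_reals all_analysis.
From mathcomp Require Import zify lra.
Set Implicit Arguments.
Unset Strict Implicit.
Unset Printing Implicit Defensive.
Import Order.TTheory GRing.Theory Num.Theory.
Import numFieldNormedType.Exports.

(** * Layered branching programs *)

Lemma acyclic_of_rank (n : nat) (G : lgraph n) (rank : vertex G -> nat) :
  (forall e : edge G, rank (src e) < rank (tgt e)) -> acyclic G.
Proof.
move=> rk v c; apply/negP => /= vc.
have: path (fun u w : vertex G => rank u < rank w) v (rcons c v).
  by apply: sub_path vc => u w /existsP[e /andP[/eqP <- /eqP <-]].
have tr : transitive (fun u w : vertex G => rank u < rank w).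
  by move=> a b d; exact: ltn_trans.
move/(order_path_min tr)/allP/(_ v).
by rewrite mem_rcons mem_head ltnn => /(_ isT).
Qed.

Section LayeredProgram.
Variables (n m : nat) (S : finType).

(** One instruction describes a whole layer: every state there queries the same variable, and the
    bit read selects the update. *)
Definition instruction : Type := 'I_n * (bool -> S -> S).

Definition exec (x : {ffun 'I_n -> bool}) (s : S) (o : instruction) : S :=
  o.2 (x o.1) s.

Definition run (x : {ffun 'I_n -> bool}) (ops : seq instruction) (s : S) : S :=
  foldl (exec x) s ops.

Variables (ops : seq instruction) (start : 'I_m -> S) (out : S -> 'I_m * bool).

Let L := size ops.
Let op (k : 'I_L) : instruction := tnth (in_tuple ops) k.
Let state := (('I_L * S) + ('I_m * bool))%type.

(** [insub] fails from level [L] on, so the states after the last instruction get no layer of their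
    own: [out] merges them into the [2 * m] terminals. *)
Let at_level (k : nat) (s : S) : state :=
  if insub k is Some k' then inl (k', s) else inr (out s).

(** An edge is its source paired with the bit read, so the two edges leaving a node stay distinct
    even if their targets coincide. *)
Definition layered_program : lgraph n :=
  @LGraph n state ('I_L * S * bool)%type
    (fun e => inl e.1)
    (fun e => at_level e.1.1.+1 ((op e.1.1).2 e.2 e.1.2))
    (fun e => ((op e.1.1).1, e.2))
    [set at_level 0 (start i) | i : 'I_m]%SET
    [set inr (i, true) | i : 'I_m]%SET
    [set inr (i, false) | i : 'I_m]%SET.

Let G := layered_program.

Lemma layered_program_out_inl (p : 'I_L * S) :
  out_edges (inl p : vertex G) =
  [set ((p, false) : edge G); ((p, true) : edge G)]%SET.
Proof.
apply/setP => -[q b]; rewrite !inE /=.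
apply/eqP/orP => [[->]|[]/eqP[-> _ //]].
by case: b; [right | left].
Qed.

Lemma layered_program_outdegree_inl (p : 'I_L * S) :
  outdegree (inl p : vertex G) = 2.
Proof.
by rewrite /outdegree layered_program_out_inl cards2; case: eqP => // -[].
Qed.

Lemma layered_program_outdegree_inr (p : 'I_m * bool) :
  outdegree (inr p : vertex G) = 0.
Proof. by apply/eqP; rewrite cards_eq0; apply/eqP/setP => e; rewrite !inE. Qed.

Lemma layered_program_branching : branching_program G.
Proof.
split.
(* Each edge raises the layer index; terminals have rank [L], above all layers. *)
- apply: (@acyclic_of_rank _ _ (fun v : vertex G =>
    if v is inl (k, _) then nat_of_ord k else L)) => -[[k s] b] /=.
  by rewrite /at_level; case: insubP => [k' _ -> //|_ /=].
- move=> [p|p]; [right; exact: layered_program_outdegree_inl|].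
  by left; exact: layered_program_outdegree_inr.
- move=> [p|p]; last by rewrite layered_program_outdegree_inr.
  move=> _; exists (op p.1).1, (p, false), (p, true).
  by split=> //; exact: layered_program_out_inl.
- move=> [p|[i b]]; first by rewrite layered_program_outdegree_inl.
  by move=> _; case: b; [left | right]; apply/imsetP; exists i.
- rewrite -setI_eq0; apply/eqP/setP => v; rewrite !inE.
  by apply/negP => /andP[/imsetP[i _ ->] /imsetP[j _]].
Qed.

(** Induction on the number [L - k] of layers left: the edge agreeing with [x] executes one
    instruction. *)
Lemma layered_program_walk (x : {ffun 'I_n -> bool}) (k : nat) (s : S) :
    k <= L ->
  exists p : seq (edge G),
    @walk n G (at_level k s) p (inr (out (run x (drop k ops) s)))
    /\ all (agrees x) p.
Proof.
have [d] := ubnP (L - k); elim: d k s => // d IHd k s.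
rewrite ltnS => kd; rewrite leq_eqVlt => /predU1P[->|kL].
  by exists [::]; split=> //=; rewrite /at_level insubF ?ltnn ?drop_size.
pose k' := Ordinal kL.
have [||p [wp ap]] := IHd k.+1 ((op k').2 (x (op k').1) s) => //; first by lia.
exists (((k', s), x (op k').1) :: p); split=> /=; last by rewrite /agrees eqxx.
rewrite {1}/at_level (insubT (fun j => j < L) kL) eqxx /=.
by rewrite (drop_nth (op k') kL) /= /exec -(tnth_nth _ (in_tuple ops) k').
Qed.

Lemma layered_program_computes (f : {ffun 'I_n -> bool} -> bool) :
    (forall (x : {ffun 'I_n -> bool}) (i : 'I_m),
       out (run x ops (start i)) = (i, f x)) ->
  computes_times G m f.
Proof.
move=> outP.
(* The outcome of the run from [start i] recovers [i]. *)
have start_inj : injective start.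
  by move=> i j ij; have := outP [ffun=> false] i; rewrite ij outP => -[].
exists (fun i => at_level 0 (start i)), (fun i => inr (i, true)),
  (fun i => inr (i, false)); split=> //.
  split=> i j; [|by case|by case].
  rewrite /at_level; case: insubP => [k _ _ [/start_inj]//|].
  (* With no instructions the start nodes are themselves terminals [inr (out (start i))], still told
     apart by [i]. *)
  rewrite -eqn0Ngt => /eqP/size0nil ops0.
  have /= := outP [ffun=> false]; rewrite ops0 /= => outE.
  by rewrite !outE => -[].
move=> i x.
have -> : (if f x then inr (i, true) else inr (i, false)) =
  inr (i, f x) :> vertex G by case: (f x).
split; first exact: layered_program_outdegree_inr.
by rewrite -outP -[X in run x X]drop0; exact: layered_program_walk.
Qed.

Lemma bsize_layered_program : bsize G = L * #|S| + 2 * m.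
Proof. by rewrite /bsize card_sum !card_prod !card_ord card_bool mulnC; lia. Qed.

End LayeredProgram.

(** * The minimum size [b_] *)

Lemma b_le (n m : nat) (f : {ffun 'I_n -> bool} -> bool) (k : nat) :
  bp_size_achieved m f k -> b_ m f <= k.
Proof. by rewrite /b_; case: ex_minnP => j _ jmin /asboolP /jmin. Qed.

Lemma b_achieved (n m : nat) (f : {ffun 'I_n -> bool} -> bool) :
  bp_size_achieved m f (b_ m f).
Proof. by rewrite /b_; case: ex_minnP => j /asboolP. Qed.

(** * Computing [f] by translating truth tables *)

Section ShiftProgram.
Variable n : nat.

Let input := {ffun 'I_n -> bool}.
Let table := {ffun input -> bool}.
Let S := (table * bool)%type.

Definition shift (x : input) (g : table) : table :=
  [ffun y : input => g [ffun i => y i (+) x i]].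

(** The translation vector is the bit read times the [i]-th unit vector; over all [i] these vectors
    add up to the input. *)
Definition shift_step (i : 'I_n) : instruction n S :=
  (i, fun b s => (shift [ffun j => (j == i) && b] s.1, s.2)).

Lemma shiftD (x y : input) (g : table) :
  shift x (shift y g) = shift [ffun i => x i (+) y i] g.
Proof.
apply/ffunP => z; rewrite !ffunE; congr (g _).
by apply/ffunP => i; rewrite !ffunE addbA.
Qed.

Lemma shift0 (g : table) : shift [ffun=> false] g = g.
Proof.
apply/ffunP => z; rewrite !ffunE; congr (g _).
by apply/ffunP => i; rewrite !ffunE addbF.
Qed.

Lemma shiftK (x : input) : involutive (shift x).
Proof.
move=> g; rewrite shiftD -[RHS]shift0; congr shift.
by apply/ffunP => i; rewrite !ffunE addbb.
Qed.

Lemma run_shift_steps (x : input) (s : S) :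
  run x [seq shift_step i | i <- enum 'I_n] s = (shift x s.1, s.2).
Proof.
(* The shifts along [l] add up to the restriction of [x] to [l]; [uniq l] matters because a variable
   read twice cancels modulo 2. *)
have main (l : seq 'I_n) : uniq l -> forall s : S,
    run x [seq shift_step i | i <- l] s =
    (shift [ffun i => (i \in l) && x i] s.1, s.2).
  elim: l => [_ [g b]|i l IHl /= /andP[il /IHl {}IHl] {}s].
    by congr pair; rewrite -[LHS]shift0; congr shift.
  rewrite /run /= -/(run _ _ _) IHl /= shiftD; congr pair; congr shift.
  apply/ffunP => j; rewrite !ffunE in_cons.
  by case: eqVneq => [->|_]; rewrite ?(negbTE il) ?addbF.
rewrite main ?enum_uniq//; congr pair; congr shift.
by apply/ffunP => i; rewrite !ffunE mem_enum.
Qed.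

Variables (i0 : 'I_n) (f : input -> bool).

(* The two steps below ignore the input: [i0] is a dummy variable, read only
   because every instruction has to read one. *)
Definition read_step : instruction n S :=
  (i0, fun _ (s : S) => (s.1, s.2 (+) s.1 [ffun=> false])).

Definition add_step : instruction n S :=
  (i0, fun _ (s : S) => ([ffun y : input => s.1 y (+) f y], s.2)).

(** Translations modulo 2 are involutions, so the same pass serves to shift and to unshift. [f] is
    added last, when the table is back in place. *)
Definition query_steps : seq (instruction n S) :=
  [seq shift_step i | i <- enum 'I_n] ++ read_step ::
  rcons [seq shift_step i | i <- enum 'I_n] add_step.

Lemma size_query_steps : size query_steps = 2 * n + 2.
Proof.
have sz : size [seq shift_step i | i <- enum 'I_n] = n.
  by rewrite size_map size_enum_ord.
by rewrite size_cat /= size_rcons sz; lia.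
Qed.

Lemma run_query_steps (x : input) (s : S) :
  run x query_steps s = ([ffun y => s.1 y (+) f y], s.2 (+) s.1 x).
Proof.
rewrite /run foldl_cat /= foldl_rcons -!/(run _ _ _) !run_shift_steps /=.
rewrite /exec /= shiftK !ffunE; congr (_, _ (+) s.1 _).
by apply/ffunP => i; rewrite !ffunE.
Qed.

Lemma run_query_steps2 (x : input) (s : S) :
  run x (query_steps ++ query_steps) s = (s.1, s.2 (+) f x).
Proof.
rewrite /run foldl_cat -!/(run _ _ _) !run_query_steps /=; congr pair.
  by apply/ffunP => y; rewrite !ffunE -addbA addbb addbF.
by rewrite ffunE -addbA addKb.
Qed.

(** Copy [i] starts from its own table [dec i], whence the bound on [m]. The two rounds make
    [4 * n + 4] layers, each with [2 * 2 ^ (2 ^ n)] states, and [2 * m] counts the terminals. *)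
Lemma b_shift_program_le (m : nat) : 0 < m <= 2 ^ (2 ^ n) ->
  b_ m f <= (4 * n + 4) * 2 * 2 ^ (2 ^ n) + 2 * m.
Proof.
move=> /andP[m_gt0 m_le].
have cardT : #|table| = 2 ^ (2 ^ n).
  by rewrite !card_ffun !card_bool card_ord.
have m_leT : m <= #|table| by rewrite cardT.
pose dec (i : 'I_m) : table := enum_val (widen_ord m_leT i).
have dec_inj : injective dec.
  by move=> i j /enum_val_inj /(congr1 val) /= ?; exact: val_inj.
(* The default index 0 serves tables outside the image of [dec]; no computation from a start node
   ends in one. *)
pose enc (g : table) : 'I_m := odflt (Ordinal m_gt0) [pick i | dec i == g].
have decK : cancel dec enc.
  move=> i; rewrite /enc; case: pickP => [j /eqP/dec_inj //|/(_ i)].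
  by rewrite eqxx.
pose ops := query_steps ++ query_steps.
pose G := layered_program ops (fun i => (dec i, false))
  (fun s : S => (enc s.1, s.2)).
have -> : (4 * n + 4) * 2 * 2 ^ (2 ^ n) + 2 * m = bsize G.
  rewrite bsize_layered_program card_prod cardT card_bool.
  by rewrite size_cat size_query_steps; lia.
apply: b_le; exists G; split=> //; first exact: layered_program_branching.
apply: layered_program_computes => x i.
by rewrite run_query_steps2 /= decK.
Qed.

End ShiftProgram.

(** * Disjoint unions and subadditivity of [b_] *)

Section DisjointUnion.
Variables (n : nat) (G1 G2 : lgraph n).

Definition disjoint_union : lgraph n :=
  @LGraph n (vertex G1 + vertex G2)%type (edge G1 + edge G2)%type
    (fun e => match e with inl a => inl (src a) | inr a => inr (src a) end)
    (fun e => match e with inl a => inl (tgt a) | inr a => inr (tgt a) end)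
    (fun e => match e with inl a => label a | inr a => label a end)
    [set v | match v with inl u => u \in starts G1 | inr u => u \in starts G2 end]%SET
    [set v | match v with inl u => u \in accepts G1 | inr u => u \in accepts G2 end]%SET
    [set v | match v with inl u => u \in rejects G1 | inr u => u \in rejects G2 end]%SET.

Let G := disjoint_union.

Lemma disjoint_union_out_inl (v : vertex G1) :
  out_edges (inl v : vertex G) = inl @: out_edges v.
Proof.
apply/setP => -[e|e]; rewrite !inE.
  by rewrite mem_imset ?inE//; exact: inl_inj.
by symmetry; apply/negbTE/negP => /imsetP[].
Qed.

Lemma disjoint_union_out_inr (v : vertex G2) :
  out_edges (inr v : vertex G) = inr @: out_edges v.
Proof.
apply/setP => -[e|e]; rewrite !inE.
  by symmetry; apply/negbTE/negP => /imsetP[].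
by rewrite mem_imset ?inE//; exact: inr_inj.
Qed.

Lemma disjoint_union_outdegree_inl (v : vertex G1) :
  outdegree (inl v : vertex G) = outdegree v.
Proof. by rewrite /outdegree disjoint_union_out_inl card_imset//; exact: inl_inj. Qed.

Lemma disjoint_union_outdegree_inr (v : vertex G2) :
  outdegree (inr v : vertex G) = outdegree v.
Proof. by rewrite /outdegree disjoint_union_out_inr card_imset//; exact: inr_inj. Qed.

Lemma disjoint_union_walk_inl (u v : vertex G1) (p : seq (edge G1)) :
  walk (inl u : vertex G) [seq inl e | e <- p] (inl v) = walk u p v.
Proof. by elim: p u => //= e p IHp u; rewrite IHp. Qed.

Lemma disjoint_union_walk_inr (u v : vertex G2) (p : seq (edge G2)) :
  walk (inr u : vertex G) [seq inr e | e <- p] (inr v) = walk u p v.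
Proof. by elim: p u => //= e p IHp u; rewrite IHp. Qed.

Lemma disjoint_union_ends_inl (x : {ffun 'I_n -> bool}) (s t : vertex G1) :
  computation_ends x s t -> computation_ends x (inl s : vertex G) (inl t).
Proof.
move=> [t0 [p [wp ap]]]; split; first by rewrite disjoint_union_outdegree_inl.
exists [seq inl e | e <- p]; rewrite disjoint_union_walk_inl all_map.
by split.
Qed.

Lemma disjoint_union_ends_inr (x : {ffun 'I_n -> bool}) (s t : vertex G2) :
  computation_ends x s t -> computation_ends x (inr s : vertex G) (inr t).
Proof.
move=> [t0 [p [wp ap]]]; split; first by rewrite disjoint_union_outdegree_inr.
exists [seq inr e | e <- p]; rewrite disjoint_union_walk_inr all_map.
by split.
Qed.

(** No edge joins the two sides, so a cycle lies in one of them and pulls back to a cycle there. *)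
Lemma disjoint_union_acyclic : acyclic G1 -> acyclic G2 -> acyclic G.
Proof.
move=> ac1 ac2.
have inlP (u v : vertex G1) : adj (inl u : vertex G) (inl v) = adj u v.
  apply/existsP/existsP => [[[e|e] /andP[/eqP uE /eqP vE]]|[e /andP[uE vE]]] //.
    by case: uE vE => <- [<-]; exists e; rewrite !eqxx.
  by exists (inl e); apply/andP; split.
have inrP (u v : vertex G2) : adj (inr u : vertex G) (inr v) = adj u v.
  apply/existsP/existsP => [[[e|e] /andP[/eqP uE /eqP vE]]|[e /andP[uE vE]]] //.
    by case: uE vE => <- [<-]; exists e; rewrite !eqxx.
  by exists (inr e); apply/andP; split.
have adj_lr (u : vertex G1) (v : vertex G2) : adj (inl u : vertex G) (inr v) = false.
  by apply/negbTE/existsP => -[[e|e] /andP[]].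
have adj_rl (u : vertex G2) (v : vertex G1) : adj (inr u : vertex G) (inl v) = false.
  by apply/negbTE/existsP => -[[e|e] /andP[]].
have pathl (c : seq (vertex G)) (u : vertex G1) :
    path (@adj n G) (inl u) c ->
    exists2 c1 : seq (vertex G1), c = [seq inl w | w <- c1] & path (@adj n G1) u c1.
  elim: c u => [|[v|v] c IHc] u /=; [by exists [::]| |by rewrite adj_lr].
  rewrite inlP => /andP[uv /IHc[c1 -> vc1]]; exists (v :: c1) => //=.
  by rewrite uv.
have pathr (c : seq (vertex G)) (u : vertex G2) :
    path (@adj n G) (inr u) c ->
    exists2 c1 : seq (vertex G2), c = [seq inr w | w <- c1] & path (@adj n G2) u c1.
  elim: c u => [|[v|v] c IHc] u /=; [by exists [::]|by rewrite adj_rl|].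
  rewrite inrP => /andP[uv /IHc[c1 -> vc1]]; exists (v :: c1) => //=.
  by rewrite uv.
move=> [v|v] c; apply/negP => /=.
(* The pulled-back path must end at [v], which closes the cycle in [G1]. *)
- move=> /pathl[c1]; case/lastP: c1 => [|c1 w]; first by case: c.
  rewrite map_rcons => /rcons_inj[_ [<-]].
  by apply/negP; exact: ac1 v c1.
- move=> /pathr[c1]; case/lastP: c1 => [|c1 w]; first by case: c.
  rewrite map_rcons => /rcons_inj[_ [<-]].
  by apply/negP; exact: ac2 v c1.
Qed.

Lemma disjoint_union_branching :
  branching_program G1 -> branching_program G2 -> branching_program G.
Proof.
move=> bp1 bp2; split.
- by apply: disjoint_union_acyclic; exact: bp_acyclic.
- move=> [v|v].
    by rewrite disjoint_union_outdegree_inl; exact: bp_outdegree.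
  by rewrite disjoint_union_outdegree_inr; exact: bp_outdegree.
- move=> [v|v].
    rewrite disjoint_union_outdegree_inl => /(bp_label bp1)[i [e0 [e1 [vE l0 l1]]]].
    exists i, (inl e0), (inl e1); split=> //.
    by rewrite disjoint_union_out_inl vE imsetU1 imset_set1.
  rewrite disjoint_union_outdegree_inr => /(bp_label bp2)[i [e0 [e1 [vE l0 l1]]]].
  exists i, (inr e0), (inr e1); split=> //.
  by rewrite disjoint_union_out_inr vE imsetU1 imset_set1.
- move=> [v|v]; rewrite !inE.
    by rewrite disjoint_union_outdegree_inl; exact: bp_terminal.
  by rewrite disjoint_union_outdegree_inr; exact: bp_terminal.
- have := bp_disjoint bp1; have := bp_disjoint bp2.
  rewrite -!setI_eq0 => /eqP/setP d2 /eqP/setP d1.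
  apply/eqP/setP => -[v|v]; first by have := d1 v; rewrite !inE.
  by have := d2 v; rewrite !inE.
Qed.

Lemma disjoint_union_computes (m k : nat) (f : {ffun 'I_n -> bool} -> bool) :
  computes_times G1 m f -> computes_times G2 k f -> computes_times G (m + k) f.
Proof.
move=> [s1 [a1 [r1 [[s1i a1i r1i] [s1E a1E r1E] c1]]]].
move=> [s2 [a2 [r2 [[s2i a2i r2i] [s2E a2E r2E] c2]]]].
(* The first [m] indices go to [G1], the remaining [k] to [G2]. *)
pose glue (h1 : 'I_m -> vertex G1) (h2 : 'I_k -> vertex G2) (i : 'I_(m + k)) :
  vertex G := match fintype.split i with inl j => inl (h1 j) | inr j => inr (h2 j) end.
have glue_inj h1 h2 : injective h1 -> injective h2 -> injective (glue h1 h2).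
  move=> h1i h2i i j ij; rewrite -[LHS]splitK -[RHS]splitK.
  move: ij; rewrite /glue.
  by case: (fintype.split i) => a; case: (fintype.split j) => b // -[]; [move/h1i->|move/h2i->].
have glueE h1 h2 (A1 : {set vertex G1}) (A2 : {set vertex G2}) :
    A1 = [set h1 i | i : 'I_m]%SET -> A2 = [set h2 i | i : 'I_k]%SET ->
    [set v : vertex G | match v with inl u => u \in A1 | inr u => u \in A2 end]%SET
    = [set glue h1 h2 i | i : 'I_(m + k)]%SET.
  move=> -> ->; apply/setP => v; rewrite inE; apply/idP/imsetP => [|[i _ ->]].
    case: v => v /imsetP[j _ ->].
      by exists (unsplit (inl j)); rewrite // /glue unsplitK.
    by exists (unsplit (inr j)); rewrite // /glue unsplitK.
  by rewrite /glue; case: (fintype.split i) => j; exact: finset.imset_f.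
exists (glue s1 s2), (glue a1 a2), (glue r1 r2); split.
- by split; exact: glue_inj.
- by split; exact: glueE.
- move=> i x; rewrite /glue; case: (fintype.split i) => j.
    have := disjoint_union_ends_inl (c1 j x); by case: (f x).
  have := disjoint_union_ends_inr (c2 j x); by case: (f x).
Qed.

End DisjointUnion.

(** Two minimal programs are placed side by side. *)
Lemma b_add_le (n m k : nat) (f : {ffun 'I_n -> bool} -> bool) :
  b_ (m + k) f <= b_ m f + b_ k f.
Proof.
have [G1 [bp1 c1 <-]] := b_achieved m f.
have [G2 [bp2 c2 <-]] := b_achieved k f.
apply: b_le; exists (disjoint_union G1 G2); split.
- exact: disjoint_union_branching.
- exact: disjoint_union_computes.
- by rewrite /bsize card_sum.
Qed.

(** * Limits of subadditive ratios and the final bounds *)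

Local Open Scope ring_scope.
Local Open Scope classical_set_scope.

(* Fekete's lemma *)
Lemma subadditive_cvgn_ratio (R : realType) (u : nat -> nat) :
    (forall m k, (u (m + k) <= u m + u k)%N) ->
  let r := fun m => (u m)%:R / m%:R : R in
  cvgn r /\ forall m, (0 < m)%N -> limn r <= r m.
Proof.
move=> usub r.
have u_mul m q k : (u (q * m + k) <= q * u m + u k)%N.
  elim: q => [//|q IHq]; rewrite !mulSn -!addnA.
  by apply: leq_trans (usub _ _) _; rewrite leq_add2l.
(* The limit will be [inf A]. Index 0 is left out: division by zero makes [r 0 = 0], which would
   force the infimum to 0. *)
pose A := [set r m | m in [set m | (0 < m)%N]].
have A0 : A !=set0 by exists (r 1%N), 1%N.
have r_ge0 m : 0 <= r m by rewrite divr_ge0.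
have Alb : has_lbound A by exists 0 => _ [m _ <-].
have infA m : (0 < m)%N -> inf A <= r m.
  by move=> m0; apply: ge_inf => //; exists m.
suff cvr : r @ \oo --> inf A.
  split; first by apply/cvg_ex; exists (inf A).
  by move=> m m0; rewrite (cvg_lim _ cvr)//; exact: infA.
apply/cvgrPdist_le => /= e e0.
(* One half of [e] pays for [r m] exceeding the infimum, the other for the remainder term
   [C / k]. *)
have e20 : 0 < e / 2 by rewrite divr_gt0.
have [_ [m /= m0 <-] rm] := inf_adherent e20 (conj A0 Alb).
(* The remainder in the division by m contributes at most C. *)
pose C := (\sum_(i < m) u i)%N.
near=> k.
have k0 : (0 < k)%N by near: k; exact: nbhs_infty_gt.
have kR : 0 < k%:R :> R by rewrite ltr0n.
have mR : 0 < m%:R :> R by rewrite ltr0n.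
rewrite distrC ger0_norm ?subr_ge0 ?infA// lerBlDl.
have Ck : C%:R / k%:R <= e / 2.
  rewrite ler_pdivrMr// mulrC -ler_pdivrMr//.
  by near: k; exact: nbhs_infty_ger.
have uk : (u k <= (k %/ m) * u m + C)%N.
  rewrite {1}(divn_eq k m); apply: leq_trans (u_mul _ _ _) _.
  by rewrite leq_add2l /C (bigD1 (Ordinal (ltn_pmod k m0)))//= leq_addr.
(* Divide [uk] by [k] and use [(k %/ m) * m <= k]. *)
have rk : r k <= r m + C%:R / k%:R.
  rewrite /r ler_pdivrMr// mulrDl -(mulrA C%:R) mulVf ?gt_eqF// mulr1.
  have kE : (k %/ m)%:R <= k%:R / m%:R :> R.
    by rewrite ler_pdivlMr// -natrM ler_nat leq_trunc_div.
  apply: (@le_trans _ _ ((k %/ m) * u m + C)%N%:R); first by rewrite ler_nat.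
  by rewrite natrD natrM lerD2r mulrC -mulrA ler_wpM2l// mulrC.
lra.
Unshelve. all: by end_near.
Qed.

(* Convergence is asserted because [lim] has a default value otherwise. *)
Theorem mainTheorem2 (R : realType) (n : nat) (hn : (1 <= n)%N)
    (f : {ffun 'I_n -> bool} -> bool) :
  [/\ cvgn (b_ratio R f),
      b_avg R f <= (64 * n)%:R
    & (b_ (2 ^ (2 ^ n - 1)) f <= 32 * n * 2 ^ (2 ^ n))%N].
Proof.
(* [M] is half the number of truth tables, so there are enough tables for [M] copies. *)
set M := (2 ^ (2 ^ n - 1))%N.
have M0 : (0 < M)%N by rewrite expn_gt0.
have ME : (2 ^ (2 ^ n) = 2 * M)%N.
  by rewrite -expnS subn1 prednK// expn_gt0.
have bM : (b_ M f <= 32 * n * 2 ^ (2 ^ n))%N.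
  (* Since [n >= 1], variable 0 exists and serves as the dummy one. *)
  apply: leq_trans (b_shift_program_le (Ordinal hn) f _) _.
    by rewrite M0 ME; lia.
  (* The size is [(16 * n + 18) * M], at most [64 * n * M] because [n >= 1]. *)
  by rewrite ME; nia.
have [cv lim_le] := subadditive_cvgn_ratio R (fun m k => b_add_le m k f).
(* The limit is at most the ratio at [M], and [32 * n * 2 ^ (2 ^ n) = 64 * n * M]. *)
split=> //; apply: le_trans (lim_le _ M0) _.
rewrite ler_pdivrMr ?ltr0n// -natrM ler_nat.
by apply: leq_trans bM _; rewrite ME; lia.
Qed.
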